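(* Let $k$ be an algebraically closed field and let $\Delta$ be trinomial data over $k$ with unit partition. There exist trinomial data $\Delta'$ over $k$ in Mori form such that $k[\Delta]\cong_k k[\Delta']$.
   Context: Trinomial data with unit partition over $k$ consist of an integer $r\ge 1$, pairwise relatively prime positive integers $\beta_0,\dots,\beta_r$, and distinct elements $\lambda_2,\dots,\lambda_r\in k^*$ (the empty sequence if $r=1$). For such data $\Delta$, $$k[\Delta]=k[T_0,\dots,T_r]/(T_0^{\beta_0}+\lambda_iT_1^{\beta_1}+T_i^{\beta_i})_{2\le i\le r},$$ where $T_0,\dots,T_r$ are independent variables (so $k[\Delta]=k[T_0,T_1]$ if $r=1$). $\Delta$ is in Mori form if it is trinomial data with unit partition and either (1) $r=1$ and $\beta_0=\beta_1=1$, or (2) $r\ge 2$, $\lambda_2=1$ and $\beta_0>\beta_1>\cdots>\beta_r\ge 2$. $\cong_k$ means isomorphic as $k$-algebras. *)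

(* Defs.v *)
From HB Require Import structures.
From mathcomp Require Import all_boot all_order all_algebra.
From mathcomp Require Import generic_quotient ring_quotient.
From mathcomp.multinomials Require Import mpoly.
From mathcomp.classical Require Import boolp.

Set Implicit Arguments.
Unset Strict Implicit.
Unset Printing Implicit Defensive.

Import GRing.Theory.
Local Open Scope ring_scope.
Local Open Scope quotient_scope.

(* The sequence [tri_lam] is (lambda_2, ..., lambda_r): lambda_i has position
   i - 2, and the sequence is empty when r = 1. *)
Record trinomial_data (k : fieldType) := TrinomialData {
  tri_r : nat;
  tri_beta : 'I_tri_r.+1 -> nat;
  tri_lam : tri_r.-1.-tuple k;
  tri_r_ge1 : (1 <= tri_r)%N;
  tri_beta_gt0 : forall i, (0 < tri_beta i)%N;
  tri_beta_coprime :
    forall i j, i != j -> coprime (tri_beta i) (tri_beta j);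
  tri_lam_uniq : uniq tri_lam;
  tri_lam_neq0 : 0 \notin tri_lam
}.
Arguments tri_beta {k} t i.

Definition tri_lambda (k : fieldType) (D : trinomial_data k) (i : nat) : k :=
  nth 0 (tri_lam D) (i - 2).

Definition mori_form (k : fieldType) (D : trinomial_data k) : Prop :=
  (tri_r D = 1%N /\ forall i, tri_beta D i = 1%N) \/
  [/\ (2 <= tri_r D)%N,
      tri_lambda D 2 = 1,
      forall i j : 'I_(tri_r D).+1, (i < j)%N -> (tri_beta D j < tri_beta D i)%N
    & (2 <= tri_beta D ord_max)%N].

Section TrinomialRing.
Variables (k : fieldType) (D : trinomial_data k).

Local Notation r := (tri_r D).
Local Notation polyring := {mpoly k[r.+1]}.

(* [inord 1] has value 1 because r >= 1. *)
Definition tri_rel (i : 'I_r.+1) : polyring :=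
  'X_ord0 ^+ tri_beta D ord0
  + tri_lambda D i *: 'X_(inord 1) ^+ tri_beta D (inord 1)
  + 'X_i ^+ tri_beta D i.

(* The quotient construction of MathComp needs a boolean predicate, hence the
   classical reflection. *)
Definition tri_ideal : {pred polyring} := fun p =>
  `[< exists c : 'I_r.+1 -> polyring,
        p = \sum_(i < r.+1 | (2 <= i)%N) c i * tri_rel i >].

Fact tri_rel_at0 i : (tri_rel i).@[fun=> 0] = 0.
Proof.
by rewrite /tri_rel !mevalD mevalZ !rmorphXn /= !mevalXU
           !expr0n !gtn_eqF ?tri_beta_gt0 ?mulr0 ?addr0.
Qed.

Fact tri_ideal_closed : idealr_closed tri_ideal.
Proof.
split.
- by apply/asboolP; exists (fun=> 0); rewrite big1 // => i _; rewrite mul0r.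
- apply/negP => /asboolP[c /(congr1 (meval (fun=> 0)))].
  rewrite meval1 rmorph_sum big1 => [/eqP|i _] /=; first by rewrite oner_eq0.
  by rewrite mevalM tri_rel_at0 mulr0.
- move=> a p q /asboolP[c ->] /asboolP[d ->]; apply/asboolP.
  exists (fun i => a * c i + d i); rewrite mulr_sumr -big_split.
  by apply: eq_bigr => i _; rewrite mulrDl mulrA.
Qed.

HB.instance Definition _ :=
  isIdealr.Build polyring tri_ideal tri_ideal_closed.

Definition tri_ring := {ideal_quot tri_ideal}.
HB.instance Definition _ := GRing.ComNzRing.on tri_ring.

Local Notation tri_pi := (\pi_({ideal_quot tri_ideal}) : polyring -> tri_ring).

Definition tri_scale (a : k) (x : tri_ring) : tri_ring := tri_pi a%:MP * x.

Fact tri_scaleA a b x : tri_scale a (tri_scale b x) = tri_scale (a * b) x.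
Proof. by rewrite /tri_scale mulrA mpolyCM rmorphM. Qed.

Fact tri_scale1 : left_id 1 tri_scale.
Proof. by move=> x; rewrite /tri_scale mpolyC1 rmorph1 mul1r. Qed.

Fact tri_scaleDr : right_distributive tri_scale +%R.
Proof. by move=> a x y; rewrite /tri_scale mulrDr. Qed.

Fact tri_scaleDl x : {morph tri_scale^~ x : a b / a + b}.
Proof. by move=> a b; rewrite /tri_scale mpolyCD rmorphD mulrDl. Qed.

HB.instance Definition _ := GRing.Zmodule_isLmodule.Build k tri_ring
  tri_scaleA tri_scale1 tri_scaleDr tri_scaleDl.

Fact tri_scaleAl (a : k) (x y : tri_ring) : a *: (x * y) = a *: x * y.
Proof. exact: mulrA. Qed.

HB.instance Definition _ :=
  GRing.Lmodule_isLalgebra.Build k tri_ring tri_scaleAl.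
HB.instance Definition _ := GRing.Lalgebra_isComAlgebra.Build k tri_ring.

End TrinomialRing.
Arguments tri_rel {k} D i.
Arguments tri_ideal {k} D.

Definition alg_isomorphic (k : fieldType) (A B : comAlgType k) : Prop :=
  exists f : {lrmorphism A -> B}, bijective f.

(* Main.v *)
(* In k[Delta] the elements x_i = T_i^beta_i are the values of pairwise
   independent linear forms in two of them, so the defining relations are
   equivalent to the three-term relations
     [p q] x_i + [q i] x_p + [i p] x_q = 0,
   where [i j] is the 2 x 2 minor of the coefficient vectors; here any pair
   p != q may serve as basis.  One can thus reorder the variables so that the
   exponents decrease, eliminate every variable of exponent 1 beyond the first
   two, and absorb the coefficients by rescaling the variables, since k has
   roots.  The new lambda_i are cross-ratios, hence distinct and nonzero. *)

Require Import Defs.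
From HB Require Import structures.
From mathcomp Require Import all_boot all_order all_algebra.
From mathcomp Require Import generic_quotient ring_quotient ring.
From mathcomp.multinomials Require Import mpoly.
From mathcomp.classical Require Import boolp.

Set Implicit Arguments.
Unset Strict Implicit.
Unset Printing Implicit Defensive.

Import GRing.Theory.
Local Open Scope ring_scope.
Local Open Scope quotient_scope.

(** * Algebra maps out of a trinomial ring *)

Section UniversalProperty.
Variables (k : fieldType) (D : trinomial_data k).
Local Notation r := (tri_r D).
Local Notation polyring := {mpoly k[r.+1]}.

Definition tri_pi : {rmorphism polyring -> tri_ring D} :=
  \pi_({ideal_quot (tri_ideal D)}) : {rmorphism polyring -> {ideal_quot (tri_ideal D)}}.

Arguments tri_pi : simpl never.

Definition tri_gen (i : 'I_r.+1) : tri_ring D := tri_pi 'X_i.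

Lemma tri_pi_surj (x : tri_ring D) : exists p, x = tri_pi p.
Proof. by exists (repr x); rewrite /tri_pi /= reprK. Qed.

Lemma tri_pi_eq p q : tri_pi p = tri_pi q -> p - q \in tri_ideal D.
Proof. by move=> /eqP; rewrite /tri_pi /= -Quotient.idealrBE. Qed.

Lemma tri_pi_eq0 p : p \in tri_ideal D -> tri_pi p = 0.
Proof.
move=> pI; rewrite -(rmorph0 tri_pi); apply/eqP.
by rewrite /tri_pi /= -Quotient.idealrBE subr0.
Qed.

Lemma tri_piZ a p : tri_pi (a *: p) = a *: tri_pi p.
Proof. by rewrite -mul_mpolyC rmorphM. Qed.

Lemma tri_gen_rel (i : 'I_r.+1) : (2 <= i)%N ->
  tri_gen ord0 ^+ tri_beta D ord0
  + tri_lambda D i *: tri_gen (inord 1) ^+ tri_beta D (inord 1)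
  + tri_gen i ^+ tri_beta D i = 0.
Proof.
move=> i2; rewrite -!rmorphXn -tri_piZ -!rmorphD; apply: tri_pi_eq0.
apply/asboolP; exists (fun j => (j == i)%:R).
rewrite (bigD1 i) //= eqxx mul1r big1 ?addr0 // => j /andP[_ /negPf->].
by rewrite mul0r.
Qed.

Section Lift.
Variables (B : comAlgType k) (b : 'I_r.+1 -> B).
Hypothesis b_rel : forall i : 'I_r.+1, (2 <= i)%N ->
  b ord0 ^+ tri_beta D ord0
  + tri_lambda D i *: b (inord 1) ^+ tri_beta D (inord 1)
  + b i ^+ tri_beta D i = 0.

Let ev : {rmorphism polyring -> B} := mmap (GRing.in_alg B) b.

Definition tri_lift (x : tri_ring D) : B := ev (repr x).

(** [tri_lift] evaluates a chosen representative; [p] differs from it by a combination of the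
    relations, which evaluation at [b] kills. *)
Lemma tri_liftE p : tri_lift (tri_pi p) = ev p.
Proof.
have /asboolP[c e] : repr (tri_pi p) - p \in tri_ideal D.
  by apply: tri_pi_eq; rewrite /tri_pi /= reprK.
apply/eqP; rewrite -subr_eq0 /tri_lift -rmorphB e rmorph_sum big1 // => i i2.
rewrite rmorphM /= /tri_rel !(rmorphD, rmorphXn) /=.
by rewrite mmapZ !rmorphXn /= !mmapX !mmap1U mulr_algl b_rel // mulr0.
Qed.

Fact tri_lift_additive : zmod_morphism tri_lift.
Proof.
move=> x y; have [p ->] := tri_pi_surj x; have [q ->] := tri_pi_surj y.
by rewrite -rmorphB !tri_liftE rmorphB.
Qed.

Fact tri_lift_multiplicative : monoid_morphism tri_lift.
Proof.
split=> [|x y]; first by have := tri_liftE 1; rewrite !rmorph1.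
have [p ->] := tri_pi_surj x; have [q ->] := tri_pi_surj y.
by rewrite -rmorphM !tri_liftE rmorphM.
Qed.

Fact tri_lift_scalable : scalable tri_lift.
Proof.
move=> a x; have [p ->] := tri_pi_surj x.
by rewrite -tri_piZ !tri_liftE /= mmapZ mulr_algl.
Qed.

HB.instance Definition _ :=
  GRing.isZmodMorphism.Build (tri_ring D) B tri_lift tri_lift_additive.
HB.instance Definition _ :=
  GRing.isMonoidMorphism.Build (tri_ring D) B tri_lift tri_lift_multiplicative.
HB.instance Definition _ :=
  GRing.isScalable.Build k (tri_ring D) B *:%R tri_lift tri_lift_scalable.

(** With [tri_lrmorphism_eq] this is the universal property: later maps are built and compared on
    generators only. *)
Lemma tri_lift_exists :
  exists f : {lrmorphism tri_ring D -> B}, forall i, f (tri_gen i) = b i.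
Proof.
exists tri_lift => i; apply: etrans (tri_liftE _) _.
by rewrite /= mmapX mmap1U.
Qed.

End Lift.

Lemma tri_lrmorphism_eq (B : comAlgType k) (f g : {lrmorphism tri_ring D -> B}) :
  (forall i, f (tri_gen i) = g (tri_gen i)) -> f =1 g.
Proof.
move=> fg x; have [p ->] := tri_pi_surj x; rewrite (mpolyE p) !rmorph_sum.
apply: eq_bigr => m _; rewrite tri_piZ /= !linearZ_LR; congr (_ *: _).
rewrite mpolyXE_id !rmorph_prod /=.
by apply: eq_bigr => i _; rewrite !rmorphXn /= -/(tri_gen i) fg.
Qed.

End UniversalProperty.

(** * Linear algebra of the coefficient vectors *)

Section Brackets.
Variables (k : fieldType) (D : trinomial_data k).
Local Notation r := (tri_r D).

(** The cases are those of [tri_vec]; [inord 1] has value 1 because [tri_r D] is positive. *)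
Lemma tri_ord_ind (P : 'I_r.+1 -> Prop) :
  P ord0 -> P (inord 1) -> (forall i : 'I_r.+1, (2 <= i)%N -> P i) ->
  forall i, P i.
Proof.
move=> P0 P1 P2 i; have [/P2//|] := leqP 2 i.
rewrite ltnS leq_eqVlt ltnS leqn0 => /orP[] /eqP i_val.
  by rewrite -(_ : inord 1 = i) //; apply: val_inj; rewrite /= inordK ?ltnS ?tri_r_ge1.
by rewrite (_ : i = ord0) //; apply: val_inj.
Qed.

Lemma inord1_val : (inord 1 : 'I_r.+1) = 1%N :> nat.
Proof. by rewrite inordK // ltnS tri_r_ge1. Qed.

(* The relations of [tri_ring D] say that [T_i ^ beta_i] is the linear form with
   coefficient vector [tri_vec i] in [T_0 ^ beta_0] and [T_1 ^ beta_1]. *)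
Definition tri_vec (i : 'I_r.+1) : k * k :=
  if i == 0%N :> nat then (1, 0)
  else if i == 1%N :> nat then (0, 1) else (-1, - tri_lambda D i).

Definition bracket (i j : 'I_r.+1) : k :=
  (tri_vec i).1 * (tri_vec j).2 - (tri_vec i).2 * (tri_vec j).1.

Lemma tri_vec0 : tri_vec ord0 = (1, 0).
Proof. by []. Qed.

Lemma tri_vec1 : tri_vec (inord 1) = (0, 1).
Proof. by rewrite /tri_vec inord1_val. Qed.

Lemma tri_vec_ge2 (i : 'I_r.+1) : (2 <= i)%N -> tri_vec i = (-1, - tri_lambda D i).
Proof. by rewrite /tri_vec; case: (nat_of_ord i) => [|[]]. Qed.

Lemma tri_lam_size (i : 'I_r.+1) : (2 <= i)%N -> (i - 2 < size (tri_lam D))%N.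
Proof.
move=> i2; rewrite size_tuple; move: (ltn_ord i) i2.
by case: (nat_of_ord i) => [|[|n]] //; rewrite !subSS subn0; case: r.
Qed.

Lemma tri_lambda_neq0 (i : 'I_r.+1) : (2 <= i)%N -> tri_lambda D i != 0.
Proof.
move=> i2; apply: contraNneq (tri_lam_neq0 D) => <-.
exact: mem_nth (tri_lam_size i2).
Qed.

Lemma tri_lambda_inj (i j : 'I_r.+1) : (2 <= i)%N -> (2 <= j)%N ->
  tri_lambda D i = tri_lambda D j -> i = j.
Proof.
move=> i2 j2 /eqP; rewrite nth_uniq ?tri_lam_size ?tri_lam_uniq // => /eqP eij.
by apply: val_inj; rewrite /= -(subnK i2) eij subnK.
Qed.

Lemma bracketC i j : bracket i j = - bracket j i.
Proof. by rewrite /bracket; ring. Qed.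

Lemma bracketxx i : bracket i i = 0.
Proof. by rewrite /bracket; ring. Qed.

(** Up to sign the minors are 1, lambda_i and lambda_j - lambda_i; the lambda_i are nonzero and
    distinct. *)
Lemma bracket_neq0 i j : i != j -> bracket i j != 0.
Proof.
apply: contraNneq => /eqP; rewrite /bracket.
elim/tri_ord_ind: i => [||i i2]; elim/tri_ord_ind: j => [||j j2];
  rewrite ?tri_vec0 ?tri_vec1 ?tri_vec_ge2 //=.
all: rewrite ?(mulr0, mul0r, mulr1, mul1r, subr0, sub0r, mulN1r, mulrN1) //.
all: rewrite ?(oppr0, opprK, oppr_eq0, oner_eq0) //.
all: rewrite ?(negPf (tri_lambda_neq0 _)) //.
by rewrite subr_eq0 => /eqP /tri_lambda_inj ->.
Qed.

(** The vectors satisfy v_0 + lambda_i v_1 + v_i = 0, and the bracket is linear in its second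
    argument. *)
Lemma bracket_rel (i : 'I_r.+1) j : (2 <= i)%N ->
  bracket j ord0 + tri_lambda D i * bracket j (inord 1) + bracket j i = 0.
Proof. by move=> i2; rewrite /bracket tri_vec0 tri_vec1 (tri_vec_ge2 i2) /=; ring. Qed.

Section Relations.
Variables (B : comAlgType k) (x : 'I_r.+1 -> B).

(** Expanding each [x i] by [tri_vec] reduces the claim to the linear dependence [p q] v_i + [q i]
    v_p + [i p] v_q = 0 of three vectors in the plane. *)
Lemma tri_rel_bracket :
  (forall i : 'I_r.+1, (2 <= i)%N ->
     x ord0 + tri_lambda D i *: x (inord 1) + x i = 0) ->
  forall p q i, bracket p q *: x i + bracket q i *: x p + bracket i p *: x q = 0.
Proof.
move=> x_rel.
have xE i : x i = (tri_vec i).1 *: x ord0 + (tri_vec i).2 *: x (inord 1).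
  elim/tri_ord_ind: i => [||i i2].
  - by rewrite tri_vec0 scale1r scale0r addr0.
  - by rewrite tri_vec1 scale1r scale0r add0r.
  rewrite (tri_vec_ge2 i2) /= scaleN1r scaleNr -opprD.
  by apply/eqP; rewrite -subr_eq0 opprK addrC x_rel.
move=> p q i; rewrite (xE p) (xE q) (xE i) !scalerDr !scalerA.
rewrite [X in X + _]addrACA [LHS]addrACA -!scalerDl.
transitivity (0 *: x ord0 + 0 *: x (inord 1)); last by rewrite !scale0r addr0.
by congr (_ *: _ + _ *: _); rewrite /bracket; ring.
Qed.

(** After scaling by the nonzero [bracket p q], every term is a combination of [x p] and [x q],
    whose total coefficients vanish by [bracket_rel]. *)
Lemma bracket_tri_rel p q : p != q ->
  (forall i, bracket p q *: x i + bracket q i *: x p + bracket i p *: x q = 0) ->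
  forall i : 'I_r.+1, (2 <= i)%N ->
    x ord0 + tri_lambda D i *: x (inord 1) + x i = 0.
Proof.
move=> /bracket_neq0 pq x_rel i i2.
have xE j : bracket p q *: x j = - (bracket q j *: x p) + bracket p j *: x q.
  apply/eqP; rewrite -subr_eq0 (bracketC p j) scaleNr -opprD opprK addrA.
  by apply/eqP; apply: x_rel.
apply: (scalerI pq); rewrite scaler0 !scalerDr scalerA mulrC -scalerA !xE.
have Hq := bracket_rel q i2; have Hp := bracket_rel p i2.
transitivity ((bracket p ord0 + tri_lambda D i * bracket p (inord 1) + bracket p i) *: x q
  - (bracket q ord0 + tri_lambda D i * bracket q (inord 1) + bracket q i) *: x p).
  rewrite scalerDr scalerN !scalerA [X in X + _]addrACA [LHS]addrACA.
  by rewrite -!opprD -!scalerDl addrC.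
by rewrite Hq Hp !scale0r subr0.
Qed.

End Relations.
End Brackets.

(** * Isomorphisms that select and rescale variables *)

Section Reindexing.
Variables (k : fieldType) (D D' : trinomial_data k).
Variables (e : 'I_(tri_r D').+1 -> 'I_(tri_r D).+1).
Variables (c : 'I_(tri_r D').+1 -> k).
Hypothesis e_inj : injective e.
Hypothesis beta1 : forall j, j \notin codom e -> tri_beta D j = 1%N.
Hypothesis c_neq0 : forall i, c i != 0.
Hypothesis c0 : c ord0 = 1.
Local Notation p := (e ord0).
Local Notation q := (e (inord 1)).
(** The guard on [i] makes this vacuous when [tri_r D'] is 1: [D'] then has no relations, and the
    two kept variables may have any exponents in [D]. *)
Hypothesis beta_e : forall i : 'I_(tri_r D').+1, (2 <= i)%N ->
  [/\ tri_beta D' ord0 = tri_beta D p,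
      tri_beta D' (inord 1) = tri_beta D q
    & tri_beta D' i = tri_beta D (e i)].
(** Comparison of coefficients: relation [i] of [D'], evaluated at the rescaled generators and
    multiplied by [bracket q (e i)], becomes the three-term relation of [p], [q] and [e i]. *)
Hypothesis c_rel : forall i : 'I_(tri_r D').+1, (2 <= i)%N ->
  bracket q (e i) * (tri_lambda D' i * c (inord 1) ^+ tri_beta D' (inord 1))
    = bracket (e i) p
  /\ bracket q (e i) * c i ^+ tri_beta D' i = bracket p q.

Lemma neq_pq : p != q.
Proof. by rewrite (inj_eq e_inj) -val_eqE /= inord1_val. Qed.

Lemma tri_gen_bracket j :
  bracket p q *: tri_gen j ^+ tri_beta D j
  + bracket q j *: tri_gen p ^+ tri_beta D p
  + bracket j p *: tri_gen q ^+ tri_beta D q = 0.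
Proof.
exact: (@tri_rel_bracket _ _ _ (fun i => tri_gen i ^+ tri_beta D i) (@tri_gen_rel k D)).
Qed.

Definition reindex_img (i : 'I_(tri_r D').+1) : tri_ring D := c i *: tri_gen (e i).

Definition reindex_inv (i : 'I_(tri_r D').+1) : tri_ring D' := (c i)^-1 *: tri_gen i.

(** A dropped variable has exponent 1, so its three-term relation with [p] and [q] can be solved for
    it; this gives the second branch. *)
Definition reindex_preimg (j : 'I_(tri_r D).+1) : tri_ring D' :=
  if [pick i | e i == j] is Some i then reindex_inv i
  else - (bracket p q)^-1 *:
    (bracket q j *: reindex_inv ord0 ^+ tri_beta D p
     + bracket j p *: reindex_inv (inord 1) ^+ tri_beta D q).

Lemma reindex_preimg_codom i : reindex_preimg (e i) = reindex_inv i.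
Proof.
rewrite /reindex_preimg; case: pickP => [i' /eqP/e_inj-> //|].
by move/(_ i); rewrite eqxx.
Qed.

Lemma reindex_preimg_notin j : j \notin codom e ->
  reindex_preimg j = - (bracket p q)^-1 *:
    (bracket q j *: reindex_inv ord0 ^+ tri_beta D p
     + bracket j p *: reindex_inv (inord 1) ^+ tri_beta D q).
Proof.
rewrite /reindex_preimg => jN; case: pickP => // i /eqP ei.
by rewrite -ei codom_f in jN.
Qed.

Lemma reindex_img_rel (i : 'I_(tri_r D').+1) : (2 <= i)%N ->
  reindex_img ord0 ^+ tri_beta D' ord0
  + tri_lambda D' i *: reindex_img (inord 1) ^+ tri_beta D' (inord 1)
  + reindex_img i ^+ tri_beta D' i = 0.
Proof.
move=> i2; have [b0 b1 bi] := beta_e i2; have [l_rel ci_rel] := c_rel i2.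
have qi : bracket q (e i) != 0.
  by apply: bracket_neq0; rewrite (inj_eq e_inj) -val_eqE /= inord1_val neq_ltn i2.
apply: (scalerI qi); rewrite scaler0 /reindex_img !exprZn c0 expr1n scale1r.
rewrite !scalerDr !scalerA -mulrA l_rel ci_rel b0 b1 bi.
by rewrite addrC addrA tri_gen_bracket.
Qed.

(** It suffices to check three-term relations over the basis [p], [q]: they hold by construction for
    dropped [j], by antisymmetry for [p] and [q], and by the relations of [D'] otherwise. *)
Lemma reindex_preimg_rel (j : 'I_(tri_r D).+1) : (2 <= j)%N ->
  reindex_preimg ord0 ^+ tri_beta D ord0
  + tri_lambda D j *: reindex_preimg (inord 1) ^+ tri_beta D (inord 1)
  + reindex_preimg j ^+ tri_beta D j = 0.
Proof.
apply: (@bracket_tri_rel _ _ _ (fun j => reindex_preimg j ^+ tri_beta D j) _ _ neq_pq) => {}j.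
have pq := bracket_neq0 neq_pq.
rewrite /= !reindex_preimg_codom.
have [/codomP[i ->]|jN] := boolP (j \in codom e); last first.
  rewrite beta1 // expr1 reindex_preimg_notin // scalerA mulrN mulfV //.
  by rewrite scaleN1r -addrA addNr.
rewrite reindex_preimg_codom.
elim/tri_ord_ind: i => [||i i2].
- by rewrite bracketxx scale0r addr0 (bracketC p) scaleNr addNr.
- by rewrite bracketxx scale0r addr0 (bracketC p) scaleNr addNr.
have [b0 b1 bi] := beta_e i2; have [l_rel ci_rel] := c_rel i2.
have := tri_gen_rel i2; rewrite /reindex_inv b0 b1 bi => /(congr1 ( *:%R (bracket q (e i)))).
rewrite scaler0 !exprZn c0 invr1 expr1n scale1r => rel.
(* [c_rel] trades brackets for powers of [c], which cancel against the inverses in [reindex_inv]. *)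
rewrite -[RHS]rel !scalerDr !scalerA -l_rel -{1}ci_rel -b1 -bi -!mulrA.
by rewrite -!exprMn !mulfV // !expr1n !mulr1 -addrA addrC.
Qed.

Lemma tri_ring_reindex : alg_isomorphic (tri_ring D) (tri_ring D').
Proof.
have [f fE] := tri_lift_exists reindex_preimg_rel.
have [g gE] := tri_lift_exists reindex_img_rel.
have g_inv i : g (reindex_inv i) = tri_gen (e i).
  by rewrite /reindex_inv linearZ_LR /= gE /reindex_img scalerA mulVf // scale1r.
exists f; exists g.
- apply: (tri_lrmorphism_eq (f := g \o f) (g := idfun)) => j.
  rewrite /= fE.
  have [/codomP[i ->]|jN] := boolP (j \in codom e).
    by rewrite reindex_preimg_codom g_inv.
  rewrite reindex_preimg_notin // linearZ_LR /= raddfD /= !linearZ_LR /= !rmorphXn /= !g_inv.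
  (* The relation that dictated the image of a dropped variable, now read in [tri_ring D]. *)
  have := tri_gen_bracket j; rewrite (beta1 jN) expr1 -addrA => /eqP.
  rewrite addrC addr_eq0 => /eqP ->.
  by rewrite scalerN scalerA mulNr mulVf ?bracket_neq0 ?neq_pq // scaleN1r opprK.
- apply: (tri_lrmorphism_eq (f := f \o g) (g := idfun)) => i.
  rewrite /= gE /reindex_img linearZ_LR /= fE reindex_preimg_codom.
  by rewrite /reindex_inv scalerA mulfV // scale1r.
Qed.

End Reindexing.

(** * Trinomial data on a list of at least three variables *)

Section SubData.
Variables (k : fieldType) (D : trinomial_data k) (s : seq 'I_(tri_r D).+1).
Hypothesis s_uniq : uniq s.
Hypothesis s_size : (3 <= size s)%N.
Local Notation e n := (nth ord0 s n).

(* A cross-ratio of the points [e 0], [e 1], [e 2], [e n] of the projective line. *)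
Definition sub_lambda (n : nat) : k :=
  bracket (e n) (e 0) * bracket (e 1) (e 2)
    / (bracket (e 1) (e n) * bracket (e 2) (e 0)).

Lemma nth_bracket_neq0 i j : (i < size s)%N -> (j < size s)%N -> i != j ->
  bracket (e i) (e j) != 0.
Proof. by move=> si sj ij; rewrite bracket_neq0 ?nth_uniq. Qed.

Fact sub_lambda_neq0 n : (2 <= n < size s)%N -> sub_lambda n != 0.
Proof.
case/andP=> n2 ns; have s2 := ltnW s_size; have s1 := ltnW s2.
by rewrite !(mulf_neq0, invr_neq0) ?nth_bracket_neq0 ?(ltn_eqF n2) ?(gtn_eqF (ltnW n2)).
Qed.

(** A cross-ratio with three fixed distinct points determines the fourth point. *)
Fact sub_lambda_inj m n : (2 <= m < size s)%N -> (2 <= n < size s)%N ->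
  sub_lambda m = sub_lambda n -> m = n.
Proof.
case/andP=> m2 ms /andP[n2 ns]; have s2 := ltnW s_size; have s1 := ltnW s2.
have e1m : bracket (e 1) (e m) != 0 by rewrite nth_bracket_neq0 // ltn_eqF.
have e1n : bracket (e 1) (e n) != 0 by rewrite nth_bracket_neq0 // ltn_eqF.
have e12 : bracket (e 1) (e 2) != 0 by rewrite nth_bracket_neq0.
have e20 : bracket (e 2) (e 0) != 0 by rewrite nth_bracket_neq0.
move/eqP; rewrite /sub_lambda eqr_div ?mulf_neq0 // => /eqP lam_eq.
have : (bracket (e 1) (e 2) * bracket (e 2) (e 0))
    * (bracket (e m) (e 0) * bracket (e 1) (e n)
       - bracket (e n) (e 0) * bracket (e 1) (e m)) = 0.
  move/eqP: lam_eq; rewrite -subr_eq0 => /eqP <-; ring.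
move/eqP; rewrite mulf_eq0 (negPf (mulf_neq0 e12 e20)) /=.
(* The Plücker relation for [e 0], [e 1], [e m], [e n]. *)
rewrite (_ : _ - _ = bracket (e 1) (e 0) * bracket (e m) (e n)); last first.
  by rewrite /bracket; ring.
rewrite mulf_eq0 (negPf (nth_bracket_neq0 _ _ _)) //= => emn.
by apply/eqP; apply: contraTT emn => mn; rewrite nth_bracket_neq0.
Qed.

Fact sub_r_ge1 : (1 <= (size s).-1)%N.
Proof. by case: s s_size => [|? []]. Qed.

Fact sub_index (i : 'I_(size s).-1.+1) : (i < size s)%N.
Proof. by case: i => i /=; case: s s_size. Qed.

Fact sub_beta_coprime (i j : 'I_(size s).-1.+1) : i != j ->
  coprime (tri_beta D (e i)) (tri_beta D (e j)).
Proof. by move=> ij; rewrite tri_beta_coprime // nth_uniq ?sub_index. Qed.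

Definition sub_lam := [tuple of [seq sub_lambda n.+2 | n <- iota 0 (size s).-2]].

Fact sub_lam_index n : (n \in iota 0 (size s).-2) -> (2 <= n.+2 < size s)%N.
Proof. by rewrite mem_iota /= add0n; case: s => [|? []]. Qed.

Fact sub_lam_uniq : uniq sub_lam.
Proof.
rewrite map_inj_in_uniq ?iota_uniq // => m n /sub_lam_index ms /sub_lam_index ns.
by move/(sub_lambda_inj ms ns) => [].
Qed.

Fact sub_lam_neq0 : 0 \notin sub_lam.
Proof.
apply/mapP => -[n /sub_lam_index ns /esym/eqP].
by rewrite (negPf (sub_lambda_neq0 ns)).
Qed.

Definition sub_data : trinomial_data k :=
  TrinomialData sub_r_ge1 (fun i => tri_beta_gt0 (e i)) sub_beta_coprime
    sub_lam_uniq sub_lam_neq0.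

Lemma sub_data_lambda n : (2 <= n < size s)%N ->
  tri_lambda sub_data n = sub_lambda n.
Proof.
case/andP=> n2 ns; rewrite /tri_lambda [LHS]nth_mkseq; first by rewrite -addn2 subnK.
by case: n n2 ns => [|[|n]] // _; rewrite !subSS subn0; case: s => [|? []].
Qed.

(** The order of the points in the cross-ratio is chosen so that it equals 1 at [e 2], as Mori form
    demands. *)
Lemma sub_data_lambda2 : tri_lambda sub_data 2 = 1.
Proof.
rewrite sub_data_lambda ?s_size // /sub_lambda [X in X / _]mulrC divff //.
by have s2 := ltnW s_size; have s1 := ltnW s2; rewrite mulf_neq0 ?nth_bracket_neq0.
Qed.

End SubData.

(** * Absorbing coefficients by means of roots *)

Lemma closed_field_root (k : closedFieldType) (a : k) (n : nat) : (0 < n)%N ->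
  exists x : k, x ^+ n = a.
Proof.
(* The equation solved is X^n = a: the only lower coefficient is the constant one. *)
move=> n_gt0; have [x xn] := solve_monicpoly (fun i => if i is 0 then a else 0) n_gt0.
exists x; rewrite xn -(prednK n_gt0) big_ord_recl mulr1 big1 ?addr0 // => i _.
by rewrite mul0r.
Qed.

Lemma tri_ring_sub_data (k : closedFieldType) (D : trinomial_data k)
    (s : seq 'I_(tri_r D).+1) (s_uniq : uniq s) (s_size : (3 <= size s)%N) :
  (forall j, j \notin s -> tri_beta D j = 1%N) ->
  alg_isomorphic (tri_ring D) (tri_ring (sub_data s_uniq s_size)).
Proof.
move=> beta1; set D' := sub_data _ _.
pose e (i : 'I_(tri_r D').+1) := nth ord0 s i.
have e_inj : injective e.
  move=> i j /eqP; rewrite nth_uniq ?(sub_index s_size) // => /eqP ij.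
  exact: val_inj.
have s2 := ltnW s_size; have s1 := ltnW s2.
(* The values that [c_rel] forces on the powers of [c]. The one at 1 is read off at index 2, where
   the new lambda is 1; the cross-ratios make it fit every other index. *)
pose a (i : 'I_(tri_r D').+1) : k :=
  if i == 0%N :> nat then 1 else
  if i == 1%N :> nat then
    bracket (nth ord0 s 2) (nth ord0 s 0) / bracket (nth ord0 s 1) (nth ord0 s 2)
  else bracket (nth ord0 s 0) (nth ord0 s 1) / bracket (nth ord0 s 1) (e i).
have br := nth_bracket_neq0 s_uniq.
have a_neq0 i : a i != 0.
  rewrite /a; have [_|i0] := eqVneq (i : nat) 0%N; first exact: oner_neq0.
  have [_|i1] := eqVneq (i : nat) 1%N.
    by rewrite mulf_neq0 ?invr_neq0 ?br.
  by rewrite mulf_neq0 ?invr_neq0 ?br ?(sub_index s_size) // eq_sym.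
have [c c_root] : exists c : 'I_(tri_r D').+1 -> k, forall i, c i ^+ tri_beta D' i = a i.
  by apply: (@fin_all_exists _ (fun=> k) (fun i x => x ^+ tri_beta D' i = a i)) => i;
    exact/closed_field_root/tri_beta_gt0.
(* The root chosen at 0 may be a root of unity other than 1, while [tri_ring_reindex] asks for 1
   itself. *)
pose c' i := if i == ord0 then 1 else c i.
have c'_root i : c' i ^+ tri_beta D' i = a i.
  by rewrite /c'; case: eqP => [->|//]; rewrite expr1n.
apply: (tri_ring_reindex (e := e) (c := c')) => //.
- move=> j jN; apply: beta1; apply: contra jN => js.
  have js' : (index j s < (size s).-1.+1)%N by rewrite prednK ?index_mem.
  by apply/codomP; exists (Ordinal js'); rewrite /e nth_index.
- move=> i; apply: contraTneq (a_neq0 i) => ci; rewrite -c'_root ci negbK.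
  by rewrite expr0n gtn_eqF // tri_beta_gt0.
- move=> i i2; have si := sub_index s_size i; rewrite !c'_root.
  have e1 : e (inord 1) = nth ord0 s 1 by rewrite /e inord1_val.
  have -> : a i = bracket (nth ord0 s 0) (nth ord0 s 1) / bracket (nth ord0 s 1) (e i).
    by rewrite /a; case: (nat_of_ord i) i2 => [|[]].
  have -> : a (inord 1) =
      bracket (nth ord0 s 2) (nth ord0 s 0) / bracket (nth ord0 s 1) (nth ord0 s 2).
    by rewrite /a inord1_val.
  have ei : bracket (nth ord0 s 1) (e i) != 0 by rewrite br // ltn_eqF.
  rewrite e1 sub_data_lambda ?i2 //; split; last by rewrite mulrC divfK.
  rewrite /sub_lambda -/(e i); field.
  by rewrite ei !br.
Qed.

(** * The case of a polynomial ring in two variables *)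

Section AffinePlane.
Variable k : fieldType.

Fact plane_beta_coprime (i j : 'I_2) : i != j -> coprime 1 1.
Proof. by []. Qed.

Fact plane_lam_neq0 : 0 \notin ([tuple] : 0.-tuple k).
Proof. by []. Qed.

Definition plane_data : trinomial_data k :=
  @TrinomialData k 1 (fun=> 1%N) [tuple] isT (fun=> isT) plane_beta_coprime isT plane_lam_neq0.

End AffinePlane.

(** All variables but [i0] and [i1] are eliminated. Since [plane_data] has no relations, the
    conditions on kept exponents and scalars are vacuous. *)
Lemma tri_ring_plane (k : fieldType) (D : trinomial_data k) (i0 i1 : 'I_(tri_r D).+1) :
  i0 != i1 -> (forall j, j != i0 -> j != i1 -> tri_beta D j = 1%N) ->
  alg_isomorphic (tri_ring D) (tri_ring (plane_data k)).
Proof.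
move=> i01 beta1; pose e (i : 'I_2) := if i == ord0 then i0 else i1.
have no2 (i : 'I_2) : (2 <= i)%N -> False by rewrite leqNgt ltn_ord.
apply: (@tri_ring_reindex _ _ (plane_data k) e (fun=> 1)) => //; try by move=> i /no2.
- move=> i j; rewrite /e; have [->|ni] := eqVneq i ord0; have [->|nj] := eqVneq j ord0 => //.
  + by move/eqP; rewrite (negPf i01).
  + by move/esym/eqP; rewrite (negPf i01).
  by move=> _; apply: val_inj; move: i j ni nj => [[|[]] //= ?] [[|[]] //= ?].
- move=> j jN; apply: beta1; apply: contra jN => /eqP ->; apply/codomP.
    by exists ord0.
  by exists (@Ordinal 2 1 isT).
- by move=> i; apply: oner_neq0.
Qed.

(** * Reduction to Mori form *)

Theorem lemma6p1 (k : closedFieldType) (D : trinomial_data k) :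
  exists D' : trinomial_data k,
    mori_form D' /\ alg_isomorphic (tri_ring D) (tri_ring D').
Proof.
pose P i := (2 <= tri_beta D i)%N.
have beta_notP j : ~~ P j -> tri_beta D j = 1%N.
  by rewrite /P -leqNgt => b1; apply/eqP; rewrite eqn_leq b1 tri_beta_gt0.
pose s0 := [seq i <- enum 'I_(tri_r D).+1 | P i].
(* With at most two exponents above 1 the ring is a polynomial ring; otherwise exactly the variables
   in [s0] are kept. *)
have [s0_size|s0_size] := leqP (size s0) 2.
  (* Padding [s0] with variables of exponent 1 provides two distinct variables to keep, and these
     include all of [s0]. *)
  pose t := s0 ++ [seq i <- enum 'I_(tri_r D).+1 | ~~ P i].
  have t_perm : perm_eq t (enum 'I_(tri_r D).+1) by rewrite /t perm_filterC.
  have t_uniq : uniq t by rewrite (perm_uniq t_perm) enum_uniq.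
  have t_size : (2 <= size t)%N.
    by rewrite (perm_size t_perm) size_enum_ord ltnS tri_r_ge1.
  exists (plane_data k); split; first by left.
  apply: (@tri_ring_plane _ _ (nth ord0 t 0) (nth ord0 t 1)).
    by rewrite nth_uniq // ltnW.
  move=> j j0 j1; apply: beta_notP; apply: contraNN j1 => Pj.
  have js0 : j \in s0 by rewrite mem_filter Pj mem_enum.
  have jt : index j t = index j s0 by rewrite /t index_cat js0.
  have tj : nth ord0 t (index j t) = j by rewrite nth_index // /t mem_cat js0.
  have : (index j t < 2)%N by rewrite jt (leq_trans _ s0_size) ?index_mem.
  case: (index j t) tj => [e0|[e1|//]] _; last by rewrite e1.
  by rewrite e0 eqxx in j0.
pose ge_beta i j := (tri_beta D j <= tri_beta D i)%N.
pose s := sort ge_beta s0.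
have s_size : (3 <= size s)%N by rewrite size_sort.
have s_uniq : uniq s by rewrite sort_uniq filter_uniq ?enum_uniq.
have s_mem j : (j \in s) = P j by rewrite mem_sort mem_filter mem_enum andbT.
exists (sub_data s_uniq s_size); split; last first.
  by apply: tri_ring_sub_data => j; rewrite s_mem; apply: beta_notP.
have Pnth i : (i < size s)%N -> P (nth ord0 s i) by move=> /(mem_nth ord0); rewrite s_mem.
right; split.
- by rewrite /=; case: (size s) s_size => [|[|[]]].
- exact: sub_data_lambda2.
- move=> i j ij; have si := sub_index s_size i; have sj := sub_index s_size j.
  have ge_tr : transitive ge_beta by move=> x y z xy yz; apply: leq_trans yz xy.
  have ge_refl : reflexive ge_beta by move=> x; apply: leqnn.
  have s_sorted : sorted ge_beta s by apply: sort_sorted => x y; apply: leq_total.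
  have ge_ij : ge_beta (nth ord0 s i) (nth ord0 s j).
    by rewrite (sorted_leq_nth ge_tr ge_refl ord0 s_sorted) ?inE // ltnW.
  rewrite /= ltn_neqAle [(_ <= _)%N]ge_ij andbT.
  (* Sorting gives only a weak decrease; equal coprime exponents would be 1, contrary to [P]. *)
  apply: contraTneq (Pnth j sj) => bij.
  have : coprime (tri_beta D (nth ord0 s i)) (tri_beta D (nth ord0 s j)).
    by rewrite tri_beta_coprime // nth_uniq // ltn_eqF.
  by rewrite /P bij /coprime gcdnn => /eqP ->.
- exact: Pnth (sub_index s_size _).
Qed.
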